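(* Let $a_1,\dots,a_5,b_1,\dots,b_5$ be coordinates with the log-canonical Poisson bracket of the quiver $Q$ described in the context. The monomial $a_1a_2a_5$ is a Casimir function of this bracket; restrict to the level $a_1a_2a_5=-1$ (the rank condition). On this level set put $P=a_1a_2+a_1+1$, $N=a_1a_5+a_5+1$, let $\sigma$ be a square root of $P^2-4a_1a_2$ (then $\sigma/(a_1a_2)$ is a square root of $N^2-4a_1a_5$), and define $$v_i=b_i\ (1\le i\le 5),\qquad h_1=\tfrac{a_3}{2}(P+\sigma),\quad h_4=\tfrac{a_3}{2}(P-\sigma),\quad h_2=\tfrac{a_4}{2}\Bigl(N+\tfrac{\sigma}{a_1a_2}\Bigr),\quad h_3=\tfrac{a_4}{2}\Bigl(N-\tfrac{\sigma}{a_1a_2}\Bigr).$$ Then, at generic points: (i) the functions $\langle b_1b_2\rangle,\ \langle b_2a_3a_2a_1a_3b_3\rangle,\ \langle b_3a_4a_1a_5a_4b_4\rangle,\ \langle b_4b_5\rangle$ are equal, respectively, to $\langle v_1v_2\rangle$, $$(v_2h_4h_1v_3)^{1/2}\Bigl(1+\tfrac1{v_2}+\tfrac1{h_1v_2}+\tfrac1{h_4v_2}+\tfrac1{h_4h_1v_2}+\tfrac1{v_3h_4h_1v_2}\Bigr),$$ $$(v_3h_2h_3v_4)^{1/2}\Bigl(1+\tfrac1{v_3}+\tfrac1{v_3h_3}+\tfrac1{v_3h_2}+\tfrac1{v_3h_2h_3}+\tfrac1{v_3h_2h_3v_4}\Bigr),$$ and $\langle v_4v_5\rangle$ (the radicands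 on the two sides coincide and the same square root is taken on both sides); (ii) the Poisson bracket of $v_1,\dots,v_5,h_1,\dots,h_4$ is log-canonical and is described by the quiver of $\mathcal T_{2,1}$, i.e. by the quiver with double arrows $v_1\Rightarrow v_2$, $v_4\Rightarrow v_5$ and single arrows $v_2\to h_1$, $v_2\to h_4$, $v_3\to h_2$, $v_3\to h_3$, $v_5\to h_2$, $v_5\to h_3$, $h_1\to v_1$, $h_1\to v_3$, $h_2\to v_4$, $h_2\to h_1$, $h_3\to v_4$, $h_3\to h_4$, $h_4\to v_1$, $h_4\to v_3$.
   Context: A quiver with vertices labelled by variables $x_i$ defines the log-canonical Poisson bracket $\{x_i,x_j\}=B_{ij}x_ix_j$, where $B_{ij}$ is the number of arrows from $x_i$ to $x_j$ minus the number of arrows from $x_j$ to $x_i$. A Casimir function is a function that Poisson commutes with every function. The quiver $Q$ has vertices $a_1,\dots,a_5,b_1,\dots,b_5$, double arrows $a_1\Rightarrow a_5$, $a_2\Rightarrow a_1$, $a_5\Rightarrow a_2$, $b_1\Rightarrow b_2$, $b_4\Rightarrow b_5$, and single arrows $a_1\to a_3$, $a_4\to a_1$, $a_3\to a_2$, $a_5\to a_4$, $a_3\to b_1$, $b_2\to a_3$, $a_3\to b_3$, $b_3\to a_4$, $a_4\to b_4$, $b_5\to a_4$. (It is a seed of the cluster structure on the space $\mathcal A_5$ of $5\times5$ real unipotent upper-triangular matrices $A$; in this seed the four functions $\langle b_1b_2\rangle$, $\langle b_2a_3a_2a_1a_3b_3\rangle$, $\langle b_3a_4a_1a_5a_4b_4\rangle$,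 $\langle b_4b_5\rangle$ are the entries $G_{12},G_{23},G_{34},G_{45}$ of $A$. The rank condition is $\operatorname{rank}(A+A^T)\le 4$.) Notation: $\langle z_1z_2\cdots z_m\rangle:=(z_1z_2\cdots z_m)^{1/2}\Bigl(1+\frac1{z_1}+\frac1{z_1z_2}+\dots+\frac1{z_1z_2\cdots z_m}\Bigr)$. The quiver in (ii) encodes the Goldman bracket on the Teichmüller space $\mathcal T_{2,1}$ of hyperbolic genus $2$ surfaces with one hole, in exponential shear coordinates. *)

(* Defs.v *)
(* MathComp and MathComp-Analysis. *)
From HB Require Import structures.
From mathcomp Require Import all_boot all_order all_algebra.
From mathcomp Require Import boolp classical_sets topology normedtype derive.

Set Implicit Arguments.
Unset Strict Implicit.
Unset Printing Implicit Defensive.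

Import Order.TTheory GRing.Theory Num.Theory.
Import numFieldNormedType.Exports.

Local Open Scope classical_set_scope.
Local Open Scope ring_scope.

(* [(i, j, m)] stands for [m] arrows from [i] to [j]. *)
Definition quiver (n : nat) := seq ('I_n * 'I_n * nat).

Definition arrows n (Q : quiver n) (i j : 'I_n) : nat :=
  (\sum_(e <- Q | e.1 == (i, j)) e.2)%N.

Definition exchange_mx n (Q : quiver n) : 'M[int]_n :=
  \matrix_(i, j) ((arrows Q i j)%:Z - (arrows Q j i)%:Z).

Section Poisson.
Context {K : numFieldType} {n : nat}.
Local Notation V := 'rV[K]_n.+1.
Variable B : 'M[int]_n.+1.

(* The biderivation with {x_i, x_j} = B_ij x_i x_j.  Derivatives are taken over
   K: they are real for K a real field, complex for K = R[i]. *)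
Definition poisson (F G : V -> K) (x : V) : K :=
  \sum_i \sum_j (B i j)%:~R * x 0 i * x 0 j
    * 'D_(delta_mx 0 i) F x * 'D_(delta_mx 0 j) G x.

Definition casimir (C : V -> K) : Prop :=
  (forall x, differentiable C x) /\
  forall (G : V -> K) (x : V), differentiable G x -> poisson C G x = 0.

Definition local_extension (S : set V) (p : V) (f F : V -> K) : Prop :=
  differentiable F p /\ \forall x \near p, S x -> F x = f x.

(* The bracket induced on [S], a relatively open part of a level set of a
   Casimir function: only the values of [f] and [g] on [S] near [p] matter;
   both have an extension differentiable at [p], and the ambient bracket of any
   two such extensions takes the value [c] at [p]. *)
Definition restricted_bracket (S : set V) (f g : V -> K) (p : V) (c : K) :
    Prop :=
  [/\ exists F, local_extension S p f F,
      exists G, local_extension S p g G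
    & forall F G, local_extension S p f F -> local_extension S p g G ->
        poisson F G p = c].

End Poisson.

(* <z_1 ... z_m>, where [r] is the chosen square root of z_1 ... z_m. *)
Definition angle {K : fieldType} (r : K) (z : seq K) : K :=
  r * \sum_(0 <= k < (size z).+1) (\prod_(y <- take k z) y)^-1.

(* The vertices a_1, .., a_5, b_1, .., b_5 are numbered from 0 to 9 in this
   order; [va] and [vb] are meant for 1 <= k <= 5. *)
Definition va (k : nat) : 'I_10 := inord k.-1%N.
Definition vb (k : nat) : 'I_10 := inord (k + 4)%N.

Definition quiver_Q : quiver 10 :=
  [:: (va 1, va 5, 2%N); (va 2, va 1, 2%N); (va 5, va 2, 2%N);
      (vb 1, vb 2, 2%N); (vb 4, vb 5, 2%N);
      (va 1, va 3, 1%N); (va 4, va 1, 1%N); (va 3, va 2, 1%N); (va 5, va 4, 1%N);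
      (va 3, vb 1, 1%N); (vb 2, va 3, 1%N); (va 3, vb 3, 1%N); (vb 3, va 4, 1%N);
      (va 4, vb 4, 1%N); (vb 5, va 4, 1%N)].

(* The vertices v_1, .., v_5, h_1, .., h_4 are numbered from 0 to 8 in this
   order. *)
Definition vv (k : nat) : 'I_9 := inord k.-1%N.
Definition vh (k : nat) : 'I_9 := inord (k + 4)%N.

Definition quiver_T21 : quiver 9 :=
  [:: (vv 1, vv 2, 2%N); (vv 4, vv 5, 2%N);
      (vv 2, vh 1, 1%N); (vv 2, vh 4, 1%N); (vv 3, vh 2, 1%N); (vv 3, vh 3, 1%N);
      (vv 5, vh 2, 1%N); (vv 5, vh 3, 1%N); (vh 1, vv 1, 1%N); (vh 1, vv 3, 1%N);
      (vh 2, vv 4, 1%N); (vh 2, vh 1, 1%N); (vh 3, vv 4, 1%N); (vh 3, vh 4, 1%N);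
      (vh 4, vv 1, 1%N); (vh 4, vv 3, 1%N)].

Section Coordinates.
Context {K : numFieldType}.
Local Notation V := 'rV[K]_10.

Definition a (k : nat) (x : V) : K := x 0 (va k).
Definition b (k : nat) (x : V) : K := x 0 (vb k).

Definition a125 (x : V) : K := a 1 x * a 2 x * a 5 x.

Definition level : set V := [set x | a125 x = -1].

Definition P (x : V) : K := a 1 x * a 2 x + a 1 x + 1.
Definition N (x : V) : K := a 1 x * a 5 x + a 5 x + 1.

(* The square of sigma. *)
Definition disc (x : V) : K := P x ^+ 2 - 4 * (a 1 x * a 2 x).

(* The points where all coordinates are invertible and the square root sigma
   is unramified. *)
Definition generic (x : V) : Prop := (forall i, x 0 i != 0) /\ disc x != 0.

Variable sigma : V -> K.

Definition v (k : nat) (x : V) : K := b k x.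

Definition h1 (x : V) : K := a 3 x / 2 * (P x + sigma x).
Definition h4 (x : V) : K := a 3 x / 2 * (P x - sigma x).
Definition h2 (x : V) : K := a 4 x / 2 * (N x + sigma x / (a 1 x * a 2 x)).
Definition h3 (x : V) : K := a 4 x / 2 * (N x - sigma x / (a 1 x * a 2 x)).

Definition shear (k : 'I_9) : V -> K :=
  nth (fun=> 0) [:: v 1; v 2; v 3; v 4; v 5; h1; h2; h3; h4] k.

End Coordinates.

(* Main.v *)
Require Import Defs.
From HB Require Import structures.
From mathcomp Require Import all_boot all_order all_algebra.
From mathcomp Require Import boolp classical_sets topology normedtype derive.
From mathcomp Require Import functions landau ring.

Set Implicit Arguments.
Unset Strict Implicit.
Unset Printing Implicit Defensive.

Import Order.TTheory GRing.Theory Num.Theory.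
Import numFieldNormedType.Exports.

Local Open Scope classical_set_scope.
Local Open Scope ring_scope.

(** Why the theorem holds.

    In the logarithmic derivatives x_i dF/dx_i a log-canonical bracket is a
    constant skew form, the sum over the arrows i -> j of the 2 x 2 minors of
    the two logarithmic gradients ([poisson_log_grad]).  The logarithmic
    gradient of a_1 a_2 a_5 is a multiple of the exponent vector of this
    monomial, which lies in the kernel of the form: the monomial is a Casimir.

    A function that vanishes on the level near a point has there a logarithmic
    gradient proportional to the same exponent vector
    ([log_grad_vanishing_on_level]).  So the bracket of two functions defined
    on the level only is computed by any pair of extensions, and one
    differentiable extension of each shear coordinate suffices
    ([restricted_bracket_log_grad]).  All of them come from an extension of
    the square root sigma, and the derivative of the latter at the point is
    forced by sigma^2 = disc ([sqrt_extension]).  The implicit function theorem,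
    which fails over an incomplete field, is thereby avoided.

    What remains is finite.  The coordinates b_k pair with everything by
    inspection of the quiver.  Exchanging sigma and - sigma exchanges h_1 with
    h_4 and h_2 with h_3, so the brackets among the h_k reduce to four rational
    identities modulo sigma^2 = disc and a_1 a_2 a_5 = -1.  For the functions
    G_23 and G_34, h_1 h_4 and h_1 + h_4 (resp. h_2 h_3 and h_2 + h_3) are free
    of sigma by Vieta's formulas, and the sums of inverses on the right depend
    only on them ([angle_split]). *)

(** * Differentiable extensions *)

Section Differentiation.
Context {K : numFieldType} {V : normedModType K}.
Implicit Types (f g : V -> K) (p : V).

(** A factor that is merely continuous is enough for the product rule at a zero
    of the other factor, because its increment is multiplied by O(h). *)
Lemma is_diff_vanishing_mul f g p :
  differentiable f p -> f p = 0 -> g x @[x --> p] --> g p ->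
  is_diff p (f * g) (g p \*: 'd f p).
Proof.
move=> df fp0 gp.
have [fC fE] := (diff_locallyP p f).1 df.
have gdf_cont : continuous (g p \*: 'd f p).
  by move=> h; apply: continuousZl_tmp; exact: fC.
(* The remainder is f (h + p) (g (h + p) - g p), of size (M + 1) |h| times a
   small quantity, plus |g p| times the remainder of f; each gets e / 2. *)
have [M M0 HM] := linear_lipschitz fC.
have expansion :
    (f * g) \o shift p = cst ((f * g) p) + (g p \*: 'd f p) +o_ 0 id.
  apply/eqaddoP => e e0.
  have C0 : 0 < `|g p| + 1 by rewrite ltr_wpDl.
  have e1 : 0 < e / 2 / (`|g p| + 1) by rewrite !divr_gt0.
  have e2 : 0 < e / 2 / (M + 1) by rewrite !divr_gt0 // addr_gt0.
  have /eqaddoP fo := fE.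
  have rem1 : \forall h \near 0, `|f (h + p) - 'd f p h| <= 1 * `|h|.
    by apply: filterS (fo _ ltr01) => h /=; rewrite !fctE fp0 add0r.
  have rem2 : \forall h \near 0,
      `|f (h + p) - 'd f p h| <= e / 2 / (`|g p| + 1) * `|h|.
    by apply: filterS (fo _ e1) => h /=; rewrite !fctE fp0 add0r.
  have gs : \forall h \near 0, `|g (h + p) - g p| <= e / 2 / (M + 1).
    have : \forall x \near p, `|g x - g p| <= e / 2 / (M + 1).
      by move/cvgrPdistC_le : gp; exact.
    by rewrite (near_shift 0 p) subr0.
  near=> h.
  have fh : `|f (h + p)| <= (M + 1) * `|h|.
    rewrite -(subrK ('d f p h) (f (h + p))) (le_trans (ler_normD _ _)) //.
    by rewrite mulrDl addrC lerD // ; near: h.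
  rewrite !fctE fp0 mul0r add0r.
  have -> : f (h + p) * g (h + p) - g p *: 'd f p h =
      f (h + p) * (g (h + p) - g p) + g p * (f (h + p) - 'd f p h).
    by rewrite /GRing.scale /=; ring.
  rewrite (splitr e) mulrDl (le_trans (ler_normD _ _)) // !normrM lerD //.
    have -> : e / 2 * `|h| = (M + 1) * `|h| * (e / 2 / (M + 1)).
      by field; rewrite gt_eqF // addr_gt0.
    by rewrite ler_pM //; near: h.
  have gh : `|f (h + p) - 'd f p h| <= e / 2 / (`|g p| + 1) * `|h|.
    by near: h.
  rewrite (le_trans (ler_wpM2l _ gh)) // mulrA ler_wpM2r // mulrCA.
  rewrite ler_piMr //; first exact/ltW/divr_gt0.
  by rewrite ler_pdivrMr // mul1r lerDl.
have dE : 'd (f * g) p = g p \*: 'd f p :> (V -> K) by exact: diff_unique.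
by apply: DiffDef => //; apply/diff_locallyP; rewrite dE.
Unshelve. all: by end_near. Qed.

(** On S the identity f^2 - (f p)^2 = D - D p gives
    f = f p + (D - D p) / (f + f p).  In this quotient f may be replaced off S
    by the constant f p: the denominator stays continuous at p, and the
    numerator vanishes there, so the quotient is differentiable at p. *)
Lemma sqrt_extension (S : set V) (f D : V -> K) p :
  {within S, continuous f} -> S p -> differentiable D p ->
  (forall x, S x -> f x ^+ 2 = D x) -> f p != 0 ->
  exists F, [/\ F p = f p, \forall x \near p, S x -> F x = f x
    & is_diff p F ((2 * f p)^-1 \*: 'd D p)].
Proof.
move=> fS Sp dD fD fp0.
pose h x := if `[< S x >] then f x else f p.
have hp : h p = f p by rewrite /h asboolT.
have hC : h x @[x --> p] --> h p.
  rewrite hp => A fA.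
  have near_fA : \forall x \near p, S x -> A (f x).
    by move/subspace_continuousP: fS => /(_ _ Sp A fA).
  change (\forall x \near p, A (h x)).
  apply: filterS near_fA => x /= xA; rewrite /h.
  by case: asboolP => [/xA//|_]; exact: nbhs_singleton.
pose g x := (h x + f p)^-1.
have two_fp : h p + f p = 2 * f p by rewrite hp mulr_natl mulr2n.
have two_fp0 : h p + f p != 0 by rewrite two_fp mulf_neq0 // pnatr_eq0.
have hfC : h x + f p @[x --> p] --> h p + f p.
  by apply: cvgD => //; exact: cvg_cst.
have gC : g x @[x --> p] --> g p by exact: cvgV.
exists (cst (f p) + (D - cst (D p)) * g); split.
- by rewrite !fctE subrr mul0r addr0.
- have hf0 : \forall x \near p, h x + f p != 0 by exact: cvgr_neq0 hfC two_fp0.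
  apply: filterS hf0 => x hx0 Sx; move: hx0.
  rewrite !fctE /g /h asboolT // => hx0.
  by rewrite -(fD _ Sx) -(fD _ Sp) subr_sqr mulfK // addrC subrK.
- have dDD : differentiable (D - cst (D p)) p by apply: differentiableB.
  have := @is_diff_vanishing_mul (D - cst (D p)) g p dDD _ gC.
  rewrite !fctE subrr => /(_ erefl) dM.
  have -> : (2 * f p)^-1 \*: 'd D p =
      0 + g p \*: 'd (D - cst (D p)) p :> (V -> K).
    rewrite add0r /g two_fp; apply/funext => z /=.
    by rewrite diffB //= diff_cst subr0.
  exact: is_diffD.
Qed.

Lemma is_diff_translate_along (u : V -> K) (e : V) p : differentiable u p ->
  is_diff p (fun x => x + u x *: e) (fun h => h + 'd u p h *: e).
Proof.
move=> du.
have dZ : is_diff p (fun x => u x *: e) (fun h => 'd u p h *: e).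
  by apply: DiffDef; [exact: differentiableZl | exact: diffZl].
exact: (is_diffD (is_diff_id p) dZ).
Qed.

End Differentiation.

(** * Log-canonical brackets and logarithmic gradients *)

Section Quivers.
Context {K : numFieldType} {n : nat}.
Implicit Types (Q : quiver n) (l m : 'I_n -> K).

Definition skew_pairing Q l m : K :=
  \sum_(e <- Q) e.2%:R * (l e.1.1 * m e.1.2 - l e.1.2 * m e.1.1).

Lemma sum_arrows Q l m :
  \sum_i \sum_j (arrows Q i j)%:R * l i * m j
    = \sum_(e <- Q) e.2%:R * l e.1.1 * m e.1.2.
Proof.
under eq_bigr => i _ do under eq_bigr => j _ do
  rewrite /arrows natr_sum big_mkcond /= -mulrA mulr_suml.
under eq_bigr => i _ do rewrite exchange_big.
rewrite exchange_big /=; apply: eq_bigr => -[[s t] w] _ /=.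
rewrite (bigD1 s) //= (bigD1 t) //= eqxx !big1 ?addr0 ?mulrA //.
- move=> i is_; rewrite big1 // => j _; rewrite xpair_eqE eq_sym (negPf is_).
  by rewrite mul0r.
- by move=> j js; rewrite xpair_eqE eqxx eq_sym (negPf js) mul0r.
Qed.

Lemma skew_pairing_sum Q l m :
  \sum_i \sum_j (exchange_mx Q i j)%:~R * l i * m j = skew_pairing Q l m.
Proof.
under eq_bigr => i _ do under eq_bigr => j _ do
  rewrite mxE intrB -!pmulrn !mulrBl.
under eq_bigr => i _ do rewrite sumrB.
rewrite sumrB sum_arrows exchange_big /=.
under [X in _ - X]eq_bigr => i _ do under eq_bigr => j _ do rewrite mulrAC.
rewrite sum_arrows -sumrB; apply: eq_bigr => e _.
by rewrite -!mulrA -mulrBr [m _ * _]mulrC.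
Qed.

(** This form of the entries unfolds to one summand per arrow, whereas the
    conditional sum defining them unfolds to nested tests. *)
Lemma exchange_mx_skew_pairing Q i j :
  (exchange_mx Q i j)%:~R =
    skew_pairing Q (fun k => (k == i)%:R) (fun k => (k == j)%:R).
Proof.
rewrite -skew_pairing_sum (bigD1 i) //= (bigD1 j) //= !eqxx !mulr1
  !big1 ?addr0 //.
- by move=> k /negPf ki; rewrite big1 // => h _; rewrite ki mulr0 mul0r.
- by move=> k /negPf kj; rewrite kj mulr0.
Qed.

Lemma skew_pairingC Q l m : skew_pairing Q m l = - skew_pairing Q l m.
Proof.
by rewrite /skew_pairing -sumrN; apply: eq_bigr => e _; ring.
Qed.

Lemma skew_pairingDl Q l l' m :
  skew_pairing Q (fun i => l i + l' i) m
    = skew_pairing Q l m + skew_pairing Q l' m.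
Proof. by rewrite /skew_pairing -big_split; apply: eq_bigr => e _ /=; ring. Qed.

End Quivers.

Section LogGradients.
Context {K : numFieldType} {n : nat}.
Local Notation V := 'rV[K]_n.+1.
Implicit Types (F G : V -> K) (p : V) (l m : nat -> K).

Definition log_grad F p (i : 'I_n.+1) : K := p 0 i * 'D_(delta_mx 0 i) F p.

Lemma poisson_log_grad (Q : quiver n.+1) F G p :
  poisson (exchange_mx Q) F G p = skew_pairing Q (log_grad F p) (log_grad G p).
Proof.
rewrite -skew_pairing_sum; apply: eq_bigr => i _; apply: eq_bigr => j _.
by rewrite /log_grad; ring.
Qed.

(** The gradient is indexed by all natural numbers so that it can be given by
    a list and evaluated at numerals. *)
Definition has_log_grad F p l : Prop :=
  differentiable F p /\ forall i : 'I_n.+1, log_grad F p i = l i.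

Lemma has_log_grad_cst c p : has_log_grad (fun=> c) p (fun=> 0).
Proof.
split=> [|i]; first exact: differentiable_cst.
by rewrite /log_grad derive_cst mulr0.
Qed.

Lemma has_log_grad_coord (j : 'I_n.+1) p :
  has_log_grad (fun x => x 0 j) p (fun i => p 0 j * (i == j)%:R).
Proof.
have dc : differentiable (fun x : V => x 0 j) p by exact: differentiable_coord.
split=> // i; rewrite /log_grad deriveE //.
have c_lin : linear (fun x : V => x 0 j : K).
  by move=> k x y; rewrite !mxE.
pose c : {linear V -> K} := HB.pack (fun x : V => x 0 j : K)
  (GRing.isLinear.Build _ _ _ _ _ c_lin).
have -> : (fun x : V => x 0 j) = c by [].
rewrite diff_lin; last exact: coord_continuous.
rewrite /= mxE eqxx /= eq_sym.
by have [->|ij] := eqVneq i j; rewrite ?eqxx ?val_eqE ?(negPf ij) ?mulr0.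
Qed.

Lemma has_log_gradD F G p l m : has_log_grad F p l -> has_log_grad G p m ->
  has_log_grad (fun x => F x + G x) p (fun i => l i + m i).
Proof.
move=> [dF lF] [dG lG]; split=> [|i]; first exact: (differentiableD dF dG).
rewrite -lF -lG /log_grad -mulrDr; congr (_ * _).
by apply: deriveD; exact: diff_derivable.
Qed.

Lemma has_log_gradM F G p l m : has_log_grad F p l -> has_log_grad G p m ->
  has_log_grad (fun x => F x * G x) p (fun i => l i * G p + F p * m i).
Proof.
move=> [dF lF] [dG lG]; split=> [|i]; first exact: (differentiableM dF dG).
rewrite -lF -lG /log_grad.
rewrite (_ : 'D_(delta_mx 0 i) _ p = 'D_(delta_mx 0 i) (F * G) p) //.
rewrite deriveM; [|exact: diff_derivable..].
by rewrite /GRing.scale /=; ring.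
Qed.

Lemma has_log_gradV F p l : F p != 0 -> has_log_grad F p l ->
  has_log_grad (fun x => (F x)^-1) p (fun i => - (l i / F p ^+ 2)).
Proof.
move=> F0 [dF lF]; split=> [|i]; first exact: differentiableV.
rewrite -lF /log_grad deriveV //; last exact: diff_derivable.
by rewrite /GRing.scale /=; field.
Qed.

Lemma has_log_gradN F p l : has_log_grad F p l ->
  has_log_grad (fun x => - F x) p (fun i => - l i).
Proof.
move=> [dF lF]; split=> [|i]; first exact: (differentiableN dF).
rewrite -lF /log_grad -mulrN; congr (_ * _).
by apply: deriveN; exact: diff_derivable.
Qed.

Lemma eq_has_log_grad F p l m : l =1 m ->
  has_log_grad F p l -> has_log_grad F p m.
Proof. by move=> lm [dF lF]; split=> // i; rewrite lF lm. Qed.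

End LogGradients.

(** * The Casimir function and the bracket on its level *)

Lemma val_va k : (k.-1 < 10)%N -> va k = k.-1 :> nat.
Proof. exact: inordK. Qed.

Lemma val_vb k : (k + 4 < 10)%N -> vb k = (k + 4)%N :> nat.
Proof. exact: inordK. Qed.

Lemma val_vv k : (k.-1 < 9)%N -> vv k = k.-1 :> nat.
Proof. exact: inordK. Qed.

Lemma val_vh k : (k + 4 < 9)%N -> vh k = (k + 4)%N :> nat.
Proof. exact: inordK. Qed.

Section Level.
Context {K : numFieldType}.
Local Notation V := 'rV[K]_10.
Implicit Types (f g F G : V -> K) (p : V) (U : set V).

Definition a125_exponent (i : nat) : K :=
  (i == 0%N)%:R + (i == 1%N)%:R + (i == 4%N)%:R.

Lemma has_log_grad_a k p : (k.-1 < 10)%N ->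
  has_log_grad (a k) p (fun i => a k p * (i == k.-1%N)%:R).
Proof. by move=> /val_va kE; rewrite -kE; exact: has_log_grad_coord. Qed.

Lemma has_log_grad_b k p : (k + 4 < 10)%N ->
  has_log_grad (b k) p (nth 0 (ncons (k + 4) 0 [:: b k p])).
Proof.
move=> /val_vb kE; have := has_log_grad_coord (vb k) p; rewrite kE.
apply: eq_has_log_grad => i; rewrite nth_ncons.
case: ltngtP => [_|ki|->]; rewrite ?mulr0 ?subnn ?mulr1 //.
by rewrite -(subnSK ki) /= nth_nil.
Qed.

Lemma has_log_grad_a125 p :
  has_log_grad a125 p (fun i => a125 p * a125_exponent i).
Proof.
have := has_log_gradM (has_log_gradM (@has_log_grad_a 1 p isT)
  (@has_log_grad_a 2 p isT)) (@has_log_grad_a 5 p isT).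
by apply: eq_has_log_grad => i; rewrite /a125_exponent /a125 /=; ring.
Qed.

(** At every vertex the arrows to and from a_1, a_2, a_5 balance. *)
Lemma skew_pairing_a125 (c : K) (m : 'I_10 -> K) :
  skew_pairing quiver_Q (fun i => c * a125_exponent i) m = 0.
Proof.
rewrite /skew_pairing !big_cons big_nil /a125_exponent /=.
by rewrite !val_va // !val_vb //=; ring.
Qed.

Lemma casimir_a125 : casimir (exchange_mx quiver_Q) (@a125 K).
Proof.
split=> [x|G x dG]; first by have [] := has_log_grad_a125 x.
rewrite poisson_log_grad.
rewrite (_ : log_grad a125 x = fun i => a125 x * a125_exponent i).
  exact: skew_pairing_a125.
by apply/funext => i; have [_ ->] := has_log_grad_a125 x.
Qed.

Lemma level_neq0 p : level p -> [/\ a 1 p != 0, a 2 p != 0 & a 5 p != 0].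
Proof.
rewrite /level /= => pL.
have : a125 p != 0 by rewrite pL oppr_eq0 oner_eq0.
by rewrite /a125 !mulf_eq0 !negb_or => /andP[/andP[]].
Qed.

(** Moving the coordinate a_5 to - 1 / (a_1 a_2) retracts a neighbourhood of p
    onto the level.  The composite of F with this retraction r vanishes near
    p, so the chain rule expresses all partial derivatives of F through the
    one in a_5. *)
Lemma log_grad_vanishing_on_level U F p : open U -> level p -> U p ->
  differentiable F p -> (\forall x \near p, (level `&` U) x -> F x = 0) ->
  exists c : K, forall i : 'I_10, log_grad F p i = c * a125_exponent i.
Proof.
move=> oU pL pU dF F0; have [a1 a2 a5] := level_neq0 pL.
have pE : a 1 p * a 2 p * a 5 p = -1 by [].
pose e5 : V := delta_mx 0 (va 5).
(* u is the displacement of a_5; its logarithmic gradient - a_5 (1, 1, 1) in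
   (a_1, a_2, a_5) is the source of the exponent vector. *)
pose u (x : V) := - (a 1 x * a 2 x)^-1 - a 5 x.
pose r (x : V) := x + u x *: e5.
have up0 : u p = 0.
  rewrite /u -(mulfK a5 (a 1 p * a 2 p)) pE; field; exact: a5.
have rp : r p = p by rewrite /r up0 scale0r addr0.
have [du lu] : has_log_grad u p (fun i => - a 5 p * a125_exponent i).
  have a12 : a 1 p * a 2 p != 0 by rewrite mulf_neq0.
  have := has_log_gradD (has_log_gradN (has_log_gradV a12
    (has_log_gradM (@has_log_grad_a 1 p isT) (@has_log_grad_a 2 p isT))))
    (has_log_gradN (@has_log_grad_a 5 p isT)).
  apply: eq_has_log_grad => i /=; rewrite /a125_exponent.
  have -> : a 5 p = - (a 1 p * a 2 p)^-1.
    by rewrite -[_^-1]mul1r -[1]opprK -pE; field; rewrite a1 a2.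
  by field; rewrite a1 a2.
have dr : is_diff p r (fun h => h + 'd u p h *: e5).
  by exact: is_diff_translate_along.
have r_level : \forall x \near p, (level `&` U) (r x).
  have dC : r x @[x --> p] --> r p.
    by apply: differentiable_continuous; exact: ex_diff.
  have r_U : \forall x \near p, U (r x).
    by apply: dC; rewrite rp; exact: open_nbhs_nbhs.
  have neq0 k : (k.-1 < 10)%N -> a k p != 0 -> \forall x \near p, a k x != 0.
    move=> k10 ak0; have [dk _] := has_log_grad_a p k10.
    have kC : a k x @[x --> p] --> a k p by exact: differentiable_continuous.
    exact: cvgr_neq0 kC ak0.
  apply: filterS3 r_U (neq0 1 isT a1) (neq0 2 isT a2)
    => x Urx x1 x2; split=> //.
  rewrite /level /= /a125 /a !mxE -!val_eqE /= !val_va //= !mulr0 !addr0 mulr1.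
  rewrite /u /a addrC subrK.
  by move: x1 x2; rewrite /a => x1 x2; field; rewrite x1 x2.
have F_r : \forall x \near p, (F \o r) x = 0.
  have dC : r x @[x --> p] --> r p.
    by apply: differentiable_continuous; exact: ex_diff.
  have : \forall y \near r p, (level `&` U) y -> F y = 0 by rewrite rp.
  move=> /dC; apply: filterS2 r_level => x /= rx; exact.
exists (a 5 p * 'D_e5 F p) => i.
have : 'D_(delta_mx 0 i) (F \o r) p = 0.
  by rewrite (near_eq_derive _ F_r) derive_cst.
have dFr : differentiable F (r p) by rewrite rp.
rewrite deriveE; last exact: differentiable_comp.
rewrite diff_comp // /= [in X in X -> _]diff_val rp linearD linearZ /=.
move: (lu i); rewrite /log_grad -!deriveE //.
move=> lui /eqP; rewrite addr_eq0 => /eqP ->.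
by rewrite mulrN /GRing.scale /= mulrA lui; ring.
Qed.

(** Two extensions of the same function differ by a function vanishing on the
    level, hence their logarithmic gradients by an element of the kernel of
    the skew form. *)
Lemma restricted_bracket_log_grad U f g F G p : open U -> level p -> U p ->
  local_extension (level `&` U) p f F -> local_extension (level `&` U) p g G ->
  restricted_bracket (exchange_mx quiver_Q) (level `&` U) f g p
    (skew_pairing quiver_Q (log_grad F p) (log_grad G p)).
Proof.
move=> oU pL pU.
have ext_unique h H H' : local_extension (level `&` U) p h H ->
    local_extension (level `&` U) p h H' ->
    exists c : K, log_grad H' p = fun i => log_grad H p i + c * a125_exponent i.
  move=> [dH Hh] [dH' H'h].
  have [||c lc] := @log_grad_vanishing_on_level U (H' - H) p oU pL pU.
  - exact: differentiableB.
  - apply: filterS2 Hh H'h => x Hh H'h Sx.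
    by rewrite !fctE Hh // H'h // subrr.
  exists c; apply/funext => i; rewrite -lc /log_grad -mulrDr; congr (_ * _).
  by rewrite deriveB ?subrKC //; exact: diff_derivable.
move=> fF gG; split; [by exists F|by exists G|move=> F' G' fF' gG'].
rewrite poisson_log_grad.
have [c ->] := ext_unique _ _ _ fF fF'; have [d ->] := ext_unique _ _ _ gG gG'.
rewrite skew_pairingDl skew_pairing_a125 addr0.
by rewrite skew_pairingC skew_pairingDl skew_pairing_a125 addr0 -skew_pairingC.
Qed.
End Level.

(** * Logarithmic gradients of the shear coordinates *)

Section Shear.
Context {K : numFieldType}.
Local Notation V := 'rV[K]_10.
Implicit Types (sigma : V -> K) (p : V) (s : K).

Lemma has_log_grad_P p :
  has_log_grad P p (nth 0 [:: a 1 p * a 2 p + a 1 p; a 1 p * a 2 p]).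
Proof.
have := has_log_gradD (has_log_gradD (has_log_gradM (@has_log_grad_a _ 1 p isT)
  (@has_log_grad_a _ 2 p isT)) (@has_log_grad_a _ 1 p isT))
  (has_log_grad_cst 1 p).
by apply: eq_has_log_grad => -[|[|i]] /=; rewrite ?nth_nil; ring.
Qed.

Lemma has_log_grad_N p :
  has_log_grad N p (nth 0 [:: a 1 p * a 5 p; 0; 0; 0; a 1 p * a 5 p + a 5 p]).
Proof.
have := has_log_gradD (has_log_gradD (has_log_gradM (@has_log_grad_a _ 1 p isT)
  (@has_log_grad_a _ 5 p isT)) (@has_log_grad_a _ 5 p isT))
  (has_log_grad_cst 1 p).
by apply: eq_has_log_grad => -[|[|[|[|[|i]]]]] /=; rewrite ?nth_nil; ring.
Qed.

(** The components of the logarithmic gradient of sigma where sigma takes the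
    value s, obtained by differentiating sigma^2 = disc.  Here and below s is
    free, so that replacing s by - s gives the conjugate functions. *)
Definition sigma_lg1 p s : K :=
  (P p * (a 1 p * a 2 p + a 1 p) - 2 * (a 1 p * a 2 p)) / s.
Definition sigma_lg2 p s : K :=
  (P p * (a 1 p * a 2 p) - 2 * (a 1 p * a 2 p)) / s.
Definition sigma_lg p s : nat -> K := nth 0 [:: sigma_lg1 p s; sigma_lg2 p s].

Lemma has_log_grad_disc p s : s != 0 ->
  has_log_grad disc p (fun i => 2 * s * sigma_lg p s i).
Proof.
move=> s0; have lP := has_log_grad_P p.
have := has_log_gradD (has_log_gradM lP lP) (has_log_gradN
  (has_log_gradM (has_log_grad_cst 4 p) (has_log_gradM
    (@has_log_grad_a _ 1 p isT) (@has_log_grad_a _ 2 p isT)))).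
apply: eq_has_log_grad => -[|[|i]] /=; rewrite ?nth_nil.
- by rewrite /sigma_lg /sigma_lg1 /=; field.
- by rewrite /sigma_lg /sigma_lg2 /=; field.
- by rewrite /sigma_lg /= nth_nil; ring.
Qed.

Definition h1_val p s : K := a 3 p / 2 * (P p + s).
Definition h1_lg1 p s : K :=
  a 3 p / 2 * (a 1 p * a 2 p + a 1 p + sigma_lg1 p s).
Definition h1_lg2 p s : K := a 3 p / 2 * (a 1 p * a 2 p + sigma_lg2 p s).
Definition h1_lg p s : nat -> K :=
  nth 0 [:: h1_lg1 p s; h1_lg2 p s; h1_val p s].

Definition h2_val p s : K := a 4 p / 2 * (N p + s / (a 1 p * a 2 p)).
Definition h2_lg1 p s : K :=
  a 4 p / 2 * (a 1 p * a 5 p + (sigma_lg1 p s - s) / (a 1 p * a 2 p)).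
Definition h2_lg2 p s : K :=
  a 4 p / 2 * ((sigma_lg2 p s - s) / (a 1 p * a 2 p)).
Definition h2_lg5 p : K := a 4 p / 2 * (a 1 p * a 5 p + a 5 p).
Definition h2_lg p s : nat -> K :=
  nth 0 [:: h2_lg1 p s; h2_lg2 p s; 0; h2_val p s; h2_lg5 p].

Lemma has_log_grad_h1 sigma p : has_log_grad sigma p (sigma_lg p (sigma p)) ->
  has_log_grad (h1 sigma) p (h1_lg p (sigma p)).
Proof.
move=> lS; have := has_log_gradM (has_log_gradM (@has_log_grad_a _ 3 p isT)
  (has_log_grad_cst 2^-1 p)) (has_log_gradD (has_log_grad_P p) lS).
apply: eq_has_log_grad => -[|[|[|i]]]; rewrite /h1_lg /sigma_lg /= ?nth_nil.
all: by rewrite /h1_lg1 /h1_lg2 /h1_val; ring.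
Qed.

Lemma has_log_grad_h2 sigma p : a 1 p != 0 -> a 2 p != 0 ->
  has_log_grad sigma p (sigma_lg p (sigma p)) ->
  has_log_grad (h2 sigma) p (h2_lg p (sigma p)).
Proof.
move=> a1 a2 lS; have a12 : a 1 p * a 2 p != 0 by rewrite mulf_neq0.
have := has_log_gradM (has_log_gradM (@has_log_grad_a _ 4 p isT)
  (has_log_grad_cst 2^-1 p)) (has_log_gradD (has_log_grad_N p)
  (has_log_gradM lS (has_log_gradV a12 (has_log_gradM
    (@has_log_grad_a _ 1 p isT) (@has_log_grad_a _ 2 p isT))))).
apply: eq_has_log_grad => -[|[|[|[|[|i]]]]].
all: rewrite /h2_lg /sigma_lg /= ?nth_nil.
all: rewrite /h2_lg1 /h2_lg2 /h2_lg5 /h2_val.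
all: by field; rewrite ?a1 ?a2.
Qed.

Lemma has_log_grad_oppsigma sigma p :
  has_log_grad sigma p (sigma_lg p (sigma p)) ->
  has_log_grad (fun x => - sigma x) p (sigma_lg p (- sigma p)).
Proof.
move=> /has_log_gradN; apply: eq_has_log_grad => -[|[|i]].
- by rewrite /sigma_lg /= /sigma_lg1 invrN mulrN.
- by rewrite /sigma_lg /= /sigma_lg2 invrN mulrN.
- by rewrite /sigma_lg /= nth_nil oppr0.
Qed.

(** The last two entries are the conjugates of the previous two: h_3 and h_4
    arise from h_2 and h_1 by changing the sign of sigma. *)
Definition shear_lg p s (k : nat) : nat -> K :=
  nth (fun=> 0)
    [:: nth 0 (ncons 5 0 [:: b 1 p]); nth 0 (ncons 6 0 [:: b 2 p]);
        nth 0 (ncons 7 0 [:: b 3 p]); nth 0 (ncons 8 0 [:: b 4 p]);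
        nth 0 (ncons 9 0 [:: b 5 p]);
        h1_lg p s; h2_lg p s; h2_lg p (- s); h1_lg p (- s)] k.

Lemma h3E sigma : h3 sigma = h2 (fun x => - sigma x).
Proof. by apply/funext => x; rewrite /h3 /h2 mulNr. Qed.

Lemma has_log_grad_shear sigma p (k : 'I_9) : a 1 p != 0 -> a 2 p != 0 ->
  has_log_grad sigma p (sigma_lg p (sigma p)) ->
  has_log_grad (shear sigma k) p (shear_lg p (sigma p) k).
Proof.
move=> a1 a2 lS; have lNS := has_log_grad_oppsigma lS.
rewrite /shear h3E.
case: k => [[|[|[|[|[|[|[|[|[|k]]]]]]]]] //= kb].
- exact: (@has_log_grad_b _ 1).
- exact: (@has_log_grad_b _ 2).
- exact: (@has_log_grad_b _ 3).
- exact: (@has_log_grad_b _ 4).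
- exact: (@has_log_grad_b _ 5).
- exact: has_log_grad_h1.
- exact: has_log_grad_h2.
- exact: has_log_grad_h2 a1 a2 lNS.
- exact: has_log_grad_h1 lNS.
Qed.

(** The vertices a_1, .., a_5, b_1, .., b_5 are 0, .., 9. *)
Lemma skew_pairing_quiver_Q (l m : nat -> K) :
  skew_pairing quiver_Q (fun i => l i) (fun i => m i) =
    2 * (l 0%N * m 4%N - l 4%N * m 0%N) + 2 * (l 1%N * m 0%N - l 0%N * m 1%N)
    + 2 * (l 4%N * m 1%N - l 1%N * m 4%N)
    + 2 * (l 5%N * m 6%N - l 6%N * m 5%N) + 2 * (l 8%N * m 9%N - l 9%N * m 8%N)
    + (l 0%N * m 2%N - l 2%N * m 0%N) + (l 3%N * m 0%N - l 0%N * m 3%N)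
    + (l 2%N * m 1%N - l 1%N * m 2%N) + (l 4%N * m 3%N - l 3%N * m 4%N)
    + (l 2%N * m 5%N - l 5%N * m 2%N) + (l 6%N * m 2%N - l 2%N * m 6%N)
    + (l 2%N * m 7%N - l 7%N * m 2%N) + (l 7%N * m 3%N - l 3%N * m 7%N)
    + (l 3%N * m 8%N - l 8%N * m 3%N) + (l 9%N * m 3%N - l 3%N * m 9%N).
Proof.
rewrite /skew_pairing !big_cons big_nil /= !val_va // !val_vb //=; ring.
Qed.

Lemma exchange_mx_quiver_T21 (k l : 'I_9) :
  (exchange_mx quiver_T21 k l)%:~R =
    (nth 0 (nth [::]
      [:: [:: 0;  2;  0;  0;  0; -1;  0;  0; -1];
          [:: -2; 0;  0;  0;  0;  1;  0;  0;  1];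
          [:: 0;  0;  0;  0;  0; -1;  1;  1; -1];
          [:: 0;  0;  0;  0;  2;  0; -1; -1;  0];
          [:: 0;  0;  0; -2;  0;  0;  1;  1;  0];
          [:: 1; -1;  1;  0;  0;  0; -1;  0;  0];
          [:: 0;  0; -1;  1; -1;  1;  0;  0;  0];
          [:: 0;  0; -1;  1; -1;  0;  0;  0;  1];
          [:: 1; -1;  1;  0;  0;  0;  0; -1;  0]] k) l : int)%:~R :> K.
Proof.
rewrite exchange_mx_skew_pairing /skew_pairing !big_cons !big_nil /=.
rewrite -!val_eqE /= !val_vv // !val_vh //.
case: k => [[|[|[|[|[|[|[|[|[|k]]]]]]]]] kb]; last by [].
all: case: l => [[|[|[|[|[|[|[|[|[|l]]]]]]]]] lb]; last by [].
all: by rewrite /=; ring.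
Qed.

(** * Brackets among h_1, .., h_4 *)

Section HBrackets.
Variables (p : V) (s : K).
Hypotheses (pL : level p) (s0 : s != 0) (sE : s ^+ 2 = disc p).

Let a10 : a 1 p != 0. Proof. by have [] := level_neq0 pL. Qed.
Let a20 : a 2 p != 0. Proof. by have [] := level_neq0 pL. Qed.

Lemma level_a5 : a 5 p = - (a 1 p * a 2 p)^-1.
Proof.
have pE : a 1 p * a 2 p * a 5 p = -1 by [].
by rewrite -[_^-1]mul1r -[1]opprK -pE; field; rewrite a10 a20.
Qed.

(** For - s in place of s this is the bracket of h_4 and h_3: the arrows
    h_2 -> h_1 and h_3 -> h_4 are conjugate. *)
Lemma skew_pairing_h1_h2 :
  skew_pairing quiver_Q (fun i => h1_lg p s i) (fun i => h2_lg p s i)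
    = - (h1_val p s * h2_val p s).
Proof.
rewrite skew_pairing_quiver_Q /h1_lg /h2_lg /=.
rewrite /h1_lg1 /h1_lg2 /h1_val /h2_lg1 /h2_lg2 /h2_lg5 /h2_val.
rewrite /sigma_lg1 /sigma_lg2 /P /N level_a5.
move: a10 a20 s0 sE; rewrite /disc /P => a1 a2 s1 sE'.
by field: sE'; rewrite ?a1 ?a2 ?s1.
Qed.

(** For - s in place of s this is the bracket of h_4 and h_2. *)
Lemma skew_pairing_h1_h3 :
  skew_pairing quiver_Q (fun i => h1_lg p s i) (fun i => h2_lg p (- s) i) = 0.
Proof.
rewrite skew_pairing_quiver_Q /h1_lg /h2_lg /=.
rewrite /h1_lg1 /h1_lg2 /h1_val /h2_lg1 /h2_lg2 /h2_lg5 /h2_val.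
rewrite /sigma_lg1 /sigma_lg2 /P /N level_a5.
move: a10 a20 s0 sE; rewrite /disc /P => a1 a2 s1 sE'.
by field: sE'; rewrite ?a1 ?a2 ?oppr_eq0 ?s1.
Qed.

Lemma skew_pairing_h1_h4 :
  skew_pairing quiver_Q (fun i => h1_lg p s i) (fun i => h1_lg p (- s) i) = 0.
Proof.
rewrite skew_pairing_quiver_Q /h1_lg /=.
rewrite /h1_lg1 /h1_lg2 /h1_val.
rewrite /sigma_lg1 /sigma_lg2 /P.
move: a10 a20 s0 sE; rewrite /disc /P => a1 a2 s1 sE'.
by field: sE'; rewrite ?a1 ?a2 ?oppr_eq0 ?s1.
Qed.

Lemma skew_pairing_h2_h3 :
  skew_pairing quiver_Q (fun i => h2_lg p s i) (fun i => h2_lg p (- s) i) = 0.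
Proof.
rewrite skew_pairing_quiver_Q /h2_lg /=.
rewrite /h2_lg1 /h2_lg2 /h2_lg5 /h2_val.
rewrite /sigma_lg1 /sigma_lg2 /P /N level_a5.
move: a10 a20 s0 sE; rewrite /disc /P => a1 a2 s1 sE'.
by field: sE'; rewrite ?a1 ?a2 ?oppr_eq0 ?s1.
Qed.

End HBrackets.
End Shear.

(** * The bracket of the shear coordinates *)

Section ShearBrackets.
Context {K : numFieldType}.
Local Notation V := 'rV[K]_10.
Implicit Types (sigma : V -> K) (p : V).

Lemma shearE sigma p (k : 'I_9) : shear sigma k p =
  nth 0 [:: b 1 p; b 2 p; b 3 p; b 4 p; b 5 p; h1_val p (sigma p);
    h2_val p (sigma p); h2_val p (- sigma p); h1_val p (- sigma p)] k.
Proof.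
rewrite /shear h3E; case: k => [[|[|[|[|[|[|[|[|[|k]]]]]]]]] kb] //.
Qed.

Lemma skew_pairing_shear_lg sigma p (k l : 'I_9) :
  level p -> sigma p != 0 -> sigma p ^+ 2 = disc p ->
  skew_pairing quiver_Q (fun i => shear_lg p (sigma p) k i)
      (fun i => shear_lg p (sigma p) l i)
    = (exchange_mx quiver_T21 k l)%:~R * shear sigma k p * shear sigma l p.
Proof.
move=> pL; rewrite !shearE exchange_mx_quiver_T21.
move: (sigma p) => s s0 sE.
have s0' : - s != 0 by rewrite oppr_eq0.
have sE' : (- s) ^+ 2 = disc p by rewrite sqrrN.
have h12 := skew_pairing_h1_h2 pL s0 sE.
have h43 := skew_pairing_h1_h2 pL s0' sE'.
have h13 := skew_pairing_h1_h3 pL s0 sE.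
have h42 := skew_pairing_h1_h3 pL s0' sE'.
have h14 := skew_pairing_h1_h4 pL s0 sE.
have h23 := skew_pairing_h2_h3 pL s0 sE.
rewrite opprK in h42.
(* The twelve off-diagonal pairs of h's; the other pairs of coordinates are
   polynomial identities in which the entries of the gradients of the h's
   remain arbitrary. *)
have flip (l' m' : 'I_10 -> K) (c : K) :
    skew_pairing quiver_Q l' m' = c -> skew_pairing quiver_Q m' l' = - c.
  by move=> <-; exact: skew_pairingC.
have h_pairings := (h12, h43, h13, h42, h14, h23,
  flip _ _ _ h12, flip _ _ _ h43, flip _ _ _ h13, flip _ _ _ h42,
  flip _ _ _ h14, flip _ _ _ h23).
case: k => [[|[|[|[|[|[|[|[|[|k]]]]]]]]] kb]; last by [].
all: case: l => [[|[|[|[|[|[|[|[|[|l]]]]]]]]] lb]; last by [].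
all: rewrite /shear_lg /= ?h_pairings ?skew_pairing_quiver_Q /h1_lg /h2_lg /=.
all: ring.
Qed.

Lemma shear_bracket (U : set V) sigma p (k l : 'I_9) : open U ->
  {within level `&` U, continuous sigma} ->
  (forall x, level x -> U x -> sigma x ^+ 2 = disc x) ->
  level p -> U p -> sigma p != 0 ->
  restricted_bracket (exchange_mx quiver_Q) (level `&` U)
    (shear sigma k) (shear sigma l) p
    ((exchange_mx quiver_T21 k l)%:~R * shear sigma k p * shear sigma l p).
Proof.
move=> oU sC sE pL pU s0; have [a1 a2 _] := level_neq0 pL.
have [dD lD] := has_log_grad_disc p s0.
have [||F [Fp Fnear dF]] := sqrt_extension sC _ dD _ s0 => //.
  by move=> x [xL xU]; exact: sE.
have lF : has_log_grad F p (sigma_lg p (F p)).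
  split=> [|i]; first exact: ex_diff.
  rewrite Fp /log_grad deriveE // diff_val /=.
  move: (lD i); rewrite /log_grad deriveE // => lDi.
  by rewrite /GRing.scale /= mulrCA lDi; field.
have shear_ext (j : 'I_9) :
    local_extension (level `&` U) p (shear sigma j) (shear F j).
  split; first by have [] := has_log_grad_shear j a1 a2 lF.
  by apply: filterS Fnear => x Fx Sx; rewrite !shearE Fx.
have log_grad_shear (j : 'I_9) :
    log_grad (shear F j) p = fun i => shear_lg p (sigma p) j i.
  apply/funext => i; have [_ ->] := has_log_grad_shear j a1 a2 lF.
  by rewrite Fp.
rewrite -skew_pairing_shear_lg //; last exact: sE.
rewrite -!log_grad_shear; exact: restricted_bracket_log_grad.
Qed.

(** * The entries of the unipotent matrix *)

Lemma angle6 (r y1 y2 y3 y4 y5 y6 : K) : angle r [:: y1; y2; y3; y4; y5; y6] =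
  r * (1 + y1^-1 + (y1 * y2)^-1 + (y1 * y2 * y3)^-1 + (y1 * y2 * y3 * y4)^-1
    + (y1 * y2 * y3 * y4 * y5)^-1 + (y1 * y2 * y3 * y4 * y5 * y6)^-1).
Proof.
by rewrite /angle /index_iota /= !big_cons !big_nil invr1 !mulr1 addr0 !mulrA
  !addrA.
Qed.

(** The middle terms of the two sums are 1/h + 1/h' = (h + h') / (h h')
    = (1 + 1/t + 1/(tu)) / c and 1/(h h') = 1/(c^2 t u). *)
Lemma angle_split (r y c t u z h h' : K) :
  [/\ y != 0, c != 0, t != 0, u != 0 & z != 0] ->
  h * h' = c ^+ 2 * (u * t) -> h + h' = c * (u * t + u + 1) ->
  angle r [:: y; c; t; u; c; z] =
    r * (1 + 1 / y + 1 / (h * y) + 1 / (h' * y) + 1 / (h' * h * y)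
           + 1 / (z * h' * h * y)).
Proof.
move=> [y0 c0 t0 u0 z0] hM hD; rewrite angle6; congr (r * _).
have : h * h' != 0 by rewrite hM !mulf_neq0 // expf_neq0.
rewrite mulf_eq0 negb_or => /andP[h0 h'0].
transitivity
  (1 + y^-1 + ((h + h') / (h * h') + (h * h')^-1 + (h * h')^-1 / z) / y).
  by rewrite hM hD; field; rewrite y0 c0 t0 u0 z0.
by field; rewrite h0 h'0 y0 z0.
Qed.

End ShearBrackets.

Theorem mainTheorem1 (K : numFieldType) :
  casimir (exchange_mx quiver_Q) (@a125 K) /\
  forall (U : set 'rV[K]_10) (sigma : 'rV[K]_10 -> K),
    open U ->
    {within level `&` U, continuous sigma} ->
    (forall x, level x -> U x ->
      sigma x ^+ 2 = P x ^+ 2 - 4 * (a 1 x * a 2 x)) ->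
  forall x, level x -> U x -> generic x ->
  let h1 := h1 sigma x in let h2 := h2 sigma x in
  let h3 := h3 sigma x in let h4 := h4 sigma x in
  [/\ (sigma x / (a 1 x * a 2 x)) ^+ 2 = N x ^+ 2 - 4 * (a 1 x * a 5 x),
   (* (i) *)
   [/\ b 1 x * b 2 x = v 1 x * v 2 x /\
       (forall r, r ^+ 2 = b 1 x * b 2 x ->
          angle r [:: b 1 x; b 2 x] = angle r [:: v 1 x; v 2 x]),
       b 2 x * a 3 x * a 2 x * a 1 x * a 3 x * b 3 x = v 2 x * h4 * h1 * v 3 x /\
       (forall r, r ^+ 2 = b 2 x * a 3 x * a 2 x * a 1 x * a 3 x * b 3 x ->
          angle r [:: b 2 x; a 3 x; a 2 x; a 1 x; a 3 x; b 3 x] =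
          r * (1 + 1 / v 2 x + 1 / (h1 * v 2 x) + 1 / (h4 * v 2 x)
                 + 1 / (h4 * h1 * v 2 x) + 1 / (v 3 x * h4 * h1 * v 2 x))),
       b 3 x * a 4 x * a 1 x * a 5 x * a 4 x * b 4 x = v 3 x * h2 * h3 * v 4 x /\
       (forall r, r ^+ 2 = b 3 x * a 4 x * a 1 x * a 5 x * a 4 x * b 4 x ->
          angle r [:: b 3 x; a 4 x; a 1 x; a 5 x; a 4 x; b 4 x] =
          r * (1 + 1 / v 3 x + 1 / (v 3 x * h3) + 1 / (v 3 x * h2)
                 + 1 / (v 3 x * h2 * h3) + 1 / (v 3 x * h2 * h3 * v 4 x)))
     & b 4 x * b 5 x = v 4 x * v 5 x /\
       (forall r, r ^+ 2 = b 4 x * b 5 x ->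
          angle r [:: b 4 x; b 5 x] = angle r [:: v 4 x; v 5 x])]
   (* (ii) *)
   & forall k l : 'I_9,
       restricted_bracket (exchange_mx quiver_Q) (level `&` U)
         (shear sigma k) (shear sigma l) x
         ((exchange_mx quiver_T21 k l)%:~R
            * shear sigma k x * shear sigma l x)].
Proof.
split; first exact: casimir_a125.
move=> U sigma oU sC sE p pL pU [p0 disc0] H1 H2 H3 H4.
have [a1 a2 a5] := level_neq0 pL.
have sp : sigma p ^+ 2 = disc p by exact: sE.
have s0 : sigma p != 0 by rewrite -sqrf_eq0 sp.
have a5E := level_a5 pL.
have h14M : H1 * H4 = a 3 p ^+ 2 * (a 1 p * a 2 p).
  by move: sp; rewrite /H1 /H4 /h1 /h4 /disc => sp; field: sp.
have h14D : H1 + H4 = a 3 p * P p by rewrite /H1 /H4 /h1 /h4; field.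
have h23M : H2 * H3 = a 4 p ^+ 2 * (a 1 p * a 5 p).
  move: sp; rewrite /H2 /H3 /h2 /h3 /disc /P /N a5E => sp.
  by field: sp; rewrite a1 a2.
have h23D : H2 + H3 = a 4 p * N p.
  by rewrite /H2 /H3 /h2 /h3; field; rewrite a1 a2.
have neq0 j : a j p != 0 /\ b j p != 0 by split; exact: p0.
have [[[a3 b3] [a4 b4]] [_ b2]] := (neq0 3, neq0 4, neq0 2).
split; [|split|].
- move: sp; rewrite /disc /P /N a5E => sp.
  by field: sp; rewrite a1 a2.
- by [].
- split=> [|r _]; first by rewrite /v -(mulrA _ H4) (mulrC H4) h14M; ring.
  exact: angle_split.
- split=> [|r _]; first by rewrite /v -(mulrA _ H2) h23M; ring.
  rewrite (@angle_split _ _ _ _ _ _ _ H3 H2) //.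
  + congr (r * _); rewrite /v !(mulrC (b 3 p)).
    by do !congr (_ + _); congr (1 / _); ring.
  + by rewrite mulrC h23M; ring.
  + by rewrite addrC h23D /N; ring.
- by [].
- by move=> k l; exact: shear_bracket.
Qed.
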